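(* Let $P^N\in\mathcal M^{np,N}$ be realizable under $(\mathcal Q_\beta,s)$. Then $$\Psi^{+,N}(P^N)=\tilde\Psi^{+,N}(P^N),$$ i.e. the upper endpoint $\sup\{\int_{\mathcal B} g\,dQ_\beta : Q_\beta\in\mathcal Q_\beta,\ M_{\mathcal Y^N}(P^{F,s,N}(Q_\beta))=P^N\}$ of the identification set equals the value of the linear program $$\sup_{Q_\beta\in\mathcal Q_\beta}\int_{\mathcal B} g(\beta)\,dQ_\beta(\beta)\quad\text{subject to}\quad \int_{\mathcal B} t^N_l(\beta)\,dQ_\beta(\beta)=b^N_l(P^N)\ \text{ for all } l=1,\dots,\tilde L^N .$$
   Context: Write $[m]=\{1,\dots,m\}$. Let $J,T\ge 1$ be integers and $\mathcal A_T=\{A_1\times\cdots\times A_T: \varnothing\neq A_t\subseteq[J]\}$. For an integer $N\ge1$ fix a design $a_1^N,\dots,a_N^N\in\mathcal A_T$, let $\mathcal Y^N=a_1^N\times\cdots\times a_N^N$ and let $\mathcal M^{np,N}$ be the set of all probability measures on the finite set $\mathcal Y^N$. Let $(\mathcal B,\mathscr B)$ be a measurable space and $\mathcal Q_\beta$ the set of all probability measures on it. A choice kernel is a measurable map $s:\mathcal B\times\mathcal A_T\times[J]^T\to[0,1]$ (discrete $\sigma$-algebras on the finite factors) with $s(\beta,a,y)=0$ if $y\notin a$ and $\sum_{y\in a}s(\beta,a,y)=1$ for all $(\beta,a)$; fix one. For $Q_\beta\in\mathcal Q_\beta$, $P^{F,s,N}(Q_\beta)$ is the law of pairs $(\beta_i,Y_i)_{i\in[N]}$,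 independent across $i$, with $\beta_i\sim Q_\beta$ and $\mathbb P(Y_i=y\mid\beta_i)=s(\beta_i,a_i^N,y)$; $M_{\mathcal Y^N}$ maps such a law to the marginal law of $(Y_1,\dots,Y_N)$, so $M_{\mathcal Y^N}(P^{F,s,N}(Q_\beta))(y_1,\dots,y_N)=\prod_{i=1}^N\int_{\mathcal B} s(\beta,a_i^N,y_i)\,dQ_\beta(\beta)$. $P^N\in\mathcal M^{np,N}$ is realizable under $(\mathcal Q_\beta,s)$ if $P^N=M_{\mathcal Y^N}(P^{F,s,N}(Q_\beta))$ for some $Q_\beta\in\mathcal Q_\beta$. Let $g:\mathcal B\to[0,1]$ be measurable, $\tilde\Psi(Q_\beta)=\int g\,dQ_\beta$, $\Psi^N(P^N)=\{\tilde\Psi(Q_\beta): Q_\beta\in\mathcal Q_\beta,\ M_{\mathcal Y^N}(P^{F,s,N}(Q_\beta))=P^N\}$ and $\Psi^{+,N}(P^N)=\sup\Psi^N(P^N)$. Let $\mathcal D^N=\{(a,y):a\in\{a_1^N,\dots,a_N^N\},y\in a\}$, $n_a=\#\{i\in[N]:a_i^N=a\}$, and let $Q^{np,N}_{Y\mid a}(P^N)(a,y)=\frac1{n_a}\sum_{i:a_i^N=a}P^N_i(y)$ where $P^N_i$ is the $i$-th marginal of $P^N$. Let $L^N=\#\mathcal D^N$, let $(a(l),y(l))_{l\in[L^N]}$ be an ordering of $\mathcal D^N$, $t_l^N(\beta)=s(\beta,a(l),y(l))$, and $\bar b_l^N(P^N)=Q^{np,N}_{Y\mid a}(P^N)(a(l),y(l))$.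 Let $\tilde L^N+1$ be the maximal cardinality of a linearly independent subset of the functions $\{1,t_1^N,\dots,t^N_{L^N}\}$ on $\mathcal B$, with the ordering chosen so that $1,t_1^N,\dots,t^N_{\tilde L^N}$ is such a subset. Put $b^N_l(P^N)=\bar b^N_l(P^N)$ for $l\le\tilde L^N$. $\tilde\Psi^{+,N}(P^N)$ denotes the value of the linear program displayed in the claim ($\sup\varnothing=-\infty$). *)

(* Defs.v *)
From HB Require Import structures.
From mathcomp Require Import all_boot all_order all_algebra.
From mathcomp Require Import all_classical all_reals all_analysis.
From mathcomp Require Import measurable_realfun.

Set Implicit Arguments.
Unset Strict Implicit.
Unset Printing Implicit Defensive.

Import Order.TTheory GRing.Theory Num.Theory.
Local Open Scope classical_set_scope.
Local Open Scope ring_scope.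

(* Throughout, the numbers of alternatives and of periods are J.+1 and T.+1,
   which is how "at least 1" is expressed; alternatives are numbered from 0. *)

Section choice_sets.
Variables J T : nat.

Definition outcome := {ffun 'I_T.+1 -> 'I_J.+1}.

HB.instance Definition _ := Finite.on outcome.
HB.instance Definition _ := isPointed.Build outcome [ffun=> ord0].
HB.instance Definition _ := @isMeasurable.Build default_measure_display
  outcome discrete_measurable discrete_measurable0
  discrete_measurableC discrete_measurableU.

Definition is_menu (a : {set outcome}) : bool :=
  [exists A : {ffun 'I_T.+1 -> {set 'I_J.+1}},
     [forall t, A t != finset.set0]
     && (a == [set y : outcome | [forall t, y t \in A t]]%SET)].

Lemma is_menu_setT : is_menu [set: outcome]%SET.
Proof.
apply/existsP; exists [ffun=> [set: 'I_J.+1]%SET]; apply/andP; split.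
  by apply/forallP => t; rewrite ffunE; apply/set0Pn; exists ord0; rewrite inE.
apply/eqP/setP => y; rewrite !inE; apply/esym/forallP => t.
by rewrite ffunE inE.
Qed.

Definition menu := {a : {set outcome} | is_menu a}.

HB.instance Definition _ := SubFinite.on menu.
HB.instance Definition _ := isPointed.Build menu
  (exist (fun a => is_menu a) _ is_menu_setT).
HB.instance Definition _ := @isMeasurable.Build default_measure_display
  menu discrete_measurable discrete_measurable0
  discrete_measurableC discrete_measurableU.

End choice_sets.

Record choiceKernel (R : realType) (J T : nat) (d : measure_display)
    (B : measurableType d) := ChoiceKernel {
  ck_fun :> B * menu J T * outcome J T -> R ;
  ck_measurable : measurable_fun [set: B * menu J T * outcome J T] ck_fun ;
  ck_itv : forall x, 0 <= ck_fun x <= 1 ;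
  ck_supp : forall b (a : menu J T) (y : outcome J T),
    y \notin \val a -> ck_fun (b, a, y) = 0 ;
  ck_sum : forall b (a : menu J T),
    \sum_(y : outcome J T | y \in \val a) ck_fun (b, a, y) = 1 }.

Section unit_law.
Context (R : realType) (J T : nat) (d : measure_display) (B : measurableType d).
Variables (s : choiceKernel R J T B) (a : menu J T) (Q : probability B R).

(* The law of (beta, Y) with beta ~ Q and P(Y = y | beta) = s(beta, a, y). *)
Definition unit_law (A : set (B * outcome J T)) : \bar R :=
  (\int[Q]_b (\sum_(y : outcome J T) s (b, a, y) * \1_A (b, y))%:E)%E.

Lemma ck_ge0 x : 0 <= s x.
Proof. by case/andP: (ck_itv s x). Qed.

Lemma measurable_ck y : measurable_fun [set: B] (fun b => s (b, a, y)).
Proof.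
have m : measurable_fun [set: B] (fun b : B => (b, a, y)).
  by apply: measurable_fun_pair => //; exact: measurable_fun_pair.
exact: (measurableT_comp (ck_measurable s) m).
Qed.

Let sec (A : set (B * outcome J T)) y : set B := [set b | A (b, y)].

Let measurable_sec A y : measurable A -> measurable (sec A y).
Proof.
move=> mA; have := measurable_ysection y mA; congr measurable.
by apply/seteqP; split => b; rewrite /ysection/= ?inE.
Qed.

Lemma unit_lawE A : measurable A ->
  unit_law A =
  (\sum_(y : outcome J T) \int[Q]_(b in [set b | A (b, y)]) (s (b, a, y))%:E)%E.
Proof.
move=> mA; rewrite /unit_law.
under eq_integral do rewrite -sumEFin.
rewrite ge0_integral_sum//=.
- apply: eq_bigr => y _.
  rewrite [RHS]integral_mkcond; apply: eq_integral => b _.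
  rewrite patchE indicE; have [h|h] := pselect (A (b, y)).
    by rewrite !mem_set//= mulr1.
  by rewrite !memNset//= mulr0.
- move=> y; apply/measurable_EFinP; apply: measurable_funM.
    exact: measurable_ck.
  rewrite (_ : (fun _ => _) = \1_(sec A y)); last first.
    by apply/funext => b; rewrite !indicE /sec; congr (_ _)%:R; apply/idP/idP;
       rewrite !inE.
  by apply: measurable_indic; exact: measurable_sec.
- by move=> y b _; rewrite lee_fin mulr_ge0// ck_ge0.
Qed.

Let unit_law0 : unit_law set0 = 0%E.
Proof.
rewrite /unit_law; apply: integral0_eq => b _.
by rewrite big1// => y _; rewrite indic0 mulr0.
Qed.

Let unit_law_ge0 A : (0 <= unit_law A)%E.
Proof.
apply: integral_ge0 => b _; rewrite lee_fin sumr_ge0// => y _.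
by rewrite mulr_ge0// ck_ge0.
Qed.

Let unit_law_sigma_additive : semi_sigma_additive unit_law.
Proof.
move=> F mF tF mUF.
rewrite [X in _ --> X](_ : _ = (\sum_(0 <= n <oo) unit_law (F n))%E).
  by apply: is_cvg_nneseries => n _ _; exact: unit_law_ge0.
rewrite unit_lawE//.
under [RHS]eq_eseriesr do rewrite unit_lawE//.
rewrite nneseries_sum; last first.
  by move=> y n _ ; apply: integral_ge0 => b _; rewrite lee_fin ck_ge0.
apply: eq_bigr => y _.
rewrite (_ : [set b | _] = \bigcup_n sec (F n) y)//.
rewrite ge0_integral_bigcup//=.
- by move=> n; exact: measurable_sec.
- apply/measurable_EFinP; apply: measurable_funTS; exact: measurable_ck.
- by move=> b _; rewrite lee_fin ck_ge0.
- apply/trivIsetP => i j _ _ ij; move/trivIsetP : tF => /(_ i j Logic.I Logic.I ij).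
  by rewrite -!subset0 => + b [h1 h2]; apply; split; [exact: h1|exact: h2].
Qed.

HB.instance Definition _ := isMeasure.Build _ _ _ unit_law
  unit_law0 unit_law_ge0 unit_law_sigma_additive.

Let unit_law_setT : unit_law setT = 1%E.
Proof.
rewrite /unit_law; under eq_integral => b _.
  rewrite (_ : (\sum_y _) = 1); last first.
    rewrite -(ck_sum s b a) [RHS]big_mkcond/=; apply: eq_bigr => y _.
    rewrite indicT mulr1; case: ifPn => // /(ck_supp s) ->//.
  over.
rewrite integral_cst// mul1e; exact: (probability_setT Q).
Qed.

HB.instance Definition _ := Measure_isProbability.Build _ _ _ unit_law
  unit_law_setT.

End unit_law.

Section product_law.
Context (R : realType) (d : measure_display) (X : measurableType d).

Definition tcons n (x : X * n.-tuple X) : n.+1.-tuple X := cons_tuple x.1 x.2.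

Lemma measurable_tcons n : measurable_fun [set: X * n.-tuple X] (@tcons n).
Proof. by apply: measurable_cons. Qed.

HB.instance Definition _ n :=
  isMeasurableFun.Build _ _ _ _ (@tcons n) (@measurable_tcons n).

(* The joint law of independent X-valued variables x_0, ..., x_(n-1) with
   x_i distributed according to m i. *)
Fixpoint product_law n : ('I_n -> probability X R) -> probability (n.-tuple X) R :=
  match n with
  | 0 => fun=> \d_[tuple]
  | n'.+1 => fun m => distribution
      (m ord0 \x product_law (fun i => m (lift ord0 i)))%E (@tcons n')
  end.

Lemma measurable_box n (A : 'I_n -> set X) :
  (forall i, measurable (A i)) ->
  measurable [set x : n.-tuple X | forall i, A i (tnth x i)].
Proof.
move=> mA; rewrite (_ : mkset _ = \bigcap_i ((@tnth n X)^~ i @^-1` A i)).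
  apply: fin_bigcap_measurable => // i _.
  by rewrite -[X in measurable X]setTI; exact: measurable_tnth.
by apply/seteqP; split => x /= h i; [move=> _; exact: h|exact: (h i Logic.I)].
Qed.

Lemma product_law_box n (m : 'I_n -> probability X R) (A : 'I_n -> set X) :
  (forall i, measurable (A i)) ->
  product_law m [set x : n.-tuple X | forall i, A i (tnth x i)]
  = (\prod_(i < n) m i (A i))%E.
Proof.
elim: n m A => [|n IH] m A mA /=.
  by rewrite big_ord0 diracE mem_set// => -[].
rewrite /distribution /pushforward.
rewrite (_ : _ @^-1` _ =
  A ord0 `*` [set x : n.-tuple X | forall i, A (lift ord0 i) (tnth x i)]).
  have mb := @measurable_box n (fun i => A (lift ord0 i)) (fun i => mA _).
  rewrite product_measure1E//.
  rewrite big_ord_recl; congr (_ * _)%E.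
  exact: (IH (fun i => m (lift ord0 i)) (fun i => A (lift ord0 i))).
apply/seteqP; split => -[x y] /= h.
  split=> [|i]; first by have := h ord0; rewrite (tnth_nth x).
  by have := h (lift ord0 i); rewrite /tcons tnthS.
case: h => /= h1 h2 i; case: (unliftP ord0 i) => [j|] ->.
  by rewrite /tcons tnthS; exact: h2.
by rewrite (tnth_nth x).
Qed.

End product_law.

(* A finite set S of indices is independent when the family (f k), k in S, is;
   f is then injective on S, so #|S| is the number of distinct functions. *)
Definition lin_indep (R : realType) (B : Type) (I : finType) (f : I -> B -> R)
    (S : {set I}) : Prop :=
  forall c : I -> R, (forall b, \sum_(k in S) c k * f k b = 0) ->
  forall k, k \in S -> c k = 0.

Definition max_indep_card (R : realType) (B : Type) (I : finType)
    (f : I -> B -> R) : nat :=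
  \max_(S : {set I} | `[< lin_indep f S >]) #|S|.

Section model.
Context (R : realType) (J T N : nat) (d : measure_display) (B : measurableType d).
Local Notation Y := (outcome J T).

Definition profiles (a : 'I_N.+1 -> menu J T) : set (N.+1.-tuple Y) :=
  [set y | forall i, tnth y i \in \val (a i)].

(* A probability on the finite set [profiles a] is encoded as a probability on
   the ambient finite space giving mass 1 to [profiles a]. *)
Definition np_model (a : 'I_N.+1 -> menu J T) : set (probability (N.+1.-tuple Y) R) :=
  [set P | P (profiles a) = 1%E].

Definition full_law (s : choiceKernel R J T B) (a : 'I_N.+1 -> menu J T)
    (Q : probability B R) : probability (N.+1.-tuple (B * Y)) R :=
  product_law (fun i => unit_law s (a i) Q).

Definition outcomes (x : N.+1.-tuple (B * Y)) : N.+1.-tuple Y :=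
  [tuple of map snd x].

Lemma measurable_outcomes : measurable_fun [set: N.+1.-tuple (B * Y)] outcomes.
Proof.
apply/measurable_fun_tnthP => i.
rewrite (_ : _ \o _ = snd \o (fun x : N.+1.-tuple (B * Y) => tnth x i)).
  by apply: measurableT_comp => //; exact: measurable_tnth.
by apply/funext => x /=; rewrite tnth_map.
Qed.

HB.instance Definition _ := isMeasurableFun.Build _ _ _ _ outcomes
  measurable_outcomes.

Definition marginal (mu : probability (N.+1.-tuple (B * Y)) R) :
    probability (N.+1.-tuple Y) R :=
  distribution mu outcomes.

Lemma marginal_full_law (s : choiceKernel R J T B) (a : 'I_N.+1 -> menu J T)
    (Q : probability B R) (y : N.+1.-tuple Y) :
  marginal (full_law s a Q) [set y]
  = (\prod_(i < N.+1) \int[Q]_b (s (b, a i, tnth y i))%:E)%E.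
Proof.
rewrite /marginal /full_law /= /distribution /pushforward.
rewrite (_ : _ @^-1` _ =
  [set x : N.+1.-tuple (B * outcome J T) |
    forall i, (snd @^-1` [set tnth y i]) (tnth x i)]).
  have mS i : measurable (@snd B (outcome J T) @^-1` [set tnth y i]).
    by rewrite -[X in measurable X]setTI; exact: measurable_snd.
  apply: etrans (product_law_box (fun i => unit_law s (a i) Q) (A := fun i => snd @^-1` [set tnth y i]) mS) _; apply: eq_bigr => i _.
  apply: etrans (unit_lawE s (a i) Q (mS i)) _.
  rewrite (bigD1 (tnth y i))//= big1 ?adde0.
    by congr (integral _ _ _); apply/seteqP; split.
  move=> z zy; rewrite (_ : [set b | _] = set0) ?integral_set0//.
  by rewrite -subset0 => b /= zE; move: zy; rewrite zE eqxx.
apply/seteqP; split => x /= h; first by move=> i; rewrite -h tnth_map.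
by apply/eq_from_tnth => i; rewrite tnth_map.
Qed.

Definition rationalizing (s : choiceKernel R J T B) (a : 'I_N.+1 -> menu J T)
    (P : probability (N.+1.-tuple Y) R) : set (probability B R) :=
  [set Q | forall E, measurable E -> marginal (full_law s a Q) E = P E].

Definition realizable (s : choiceKernel R J T B) (a : 'I_N.+1 -> menu J T)
    (P : probability (N.+1.-tuple Y) R) : Prop :=
  exists Q, rationalizing s a P Q.

Definition target (g : B -> R) (Q : probability B R) : \bar R :=
  (\int[Q]_b (g b)%:E)%E.

Definition identified_set (s : choiceKernel R J T B) (g : B -> R)
    (a : 'I_N.+1 -> menu J T) (P : probability (N.+1.-tuple Y) R) : set (\bar R) :=
  [set target g Q | Q in rationalizing s a P].

Definition upper_endpoint (s : choiceKernel R J T B) (g : B -> R)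
    (a : 'I_N.+1 -> menu J T) (P : probability (N.+1.-tuple Y) R) : \bar R :=
  ereal_sup (identified_set s g a P).

Definition design_pairs (a : 'I_N.+1 -> menu J T) : {set menu J T * Y} :=
  [set x | (x.1 \in [set a i | i in 'I_N.+1]) && (x.2 \in \val x.1)]%SET.

Definition choice_freq (a : 'I_N.+1 -> menu J T)
    (P : probability (N.+1.-tuple Y) R) (m : menu J T) (y : Y) : R :=
  (#|[set i | a i == m]%SET|%:R)^-1
  * \sum_(i | a i == m) fine (P [set z | tnth z i = y]).

Definition is_ordering (a : 'I_N.+1 -> menu J T)
    (o : 'I_#|design_pairs a| -> menu J T * Y) : Prop :=
  injective o /\ forall x, x \in design_pairs a <-> exists l, o l = x.

Definition moment (s : choiceKernel R J T B) (L : nat)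
    (o : 'I_L -> menu J T * Y) (l : 'I_L) (b : B) : R :=
  s (b, (o l).1, (o l).2).

(* The family 1, t_1, ..., t_L; the index None stands for the constant 1. *)
Definition moment1 (s : choiceKernel R J T B) (L : nat)
    (o : 'I_L -> menu J T * Y) (k : option 'I_L) (b : B) : R :=
  if k is Some l then moment s o l b else 1.

(* Ordinals start at 0, so l < Lt selects the first Lt moments t_1, ..., t_Lt. *)
Definition adapted_ordering (s : choiceKernel R J T B)
    (a : 'I_N.+1 -> menu J T) (o : 'I_#|design_pairs a| -> menu J T * Y)
    (Lt : nat) : Prop :=
  [/\ is_ordering o,
      max_indep_card (moment1 s o) = Lt.+1 &
      lin_indep (moment1 s o)
        [set k : option 'I_#|design_pairs a|
           | if k is Some l then (l < Lt)%N else true]%SET].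

Definition lp_feasible (s : choiceKernel R J T B)
    (a : 'I_N.+1 -> menu J T) (o : 'I_#|design_pairs a| -> menu J T * Y)
    (Lt : nat) (P : probability (N.+1.-tuple Y) R) : set (probability B R) :=
  [set Q | forall l : 'I_#|design_pairs a|, (l < Lt)%N ->
     (\int[Q]_b (moment s o l b)%:E)%E = (choice_freq a P (o l).1 (o l).2)%:E].

Definition lp_value (s : choiceKernel R J T B) (g : B -> R)
    (a : 'I_N.+1 -> menu J T) (o : 'I_#|design_pairs a| -> menu J T * Y)
    (Lt : nat) (P : probability (N.+1.-tuple Y) R) : \bar R :=
  ereal_sup [set target g Q | Q in lp_feasible s o Lt P].

End model.

(* Main.v *)
(* The two programs have the same feasible set.  The outcomes are independent
   across units and live in a finite space, so their law is determined by the
   integrals of s(., a_i, y), i.e. by those of all the moments t_l; and every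
   t_l is a linear combination of 1 and the first Lt moments, so prescribing
   the integrals of the latter prescribes them all, realizability ensuring that
   the prescribed values are the right ones. *)

Require Import Defs.
From HB Require Import structures.
From mathcomp Require Import all_boot all_order all_algebra.
From mathcomp Require Import all_classical all_reals all_analysis.

Set Implicit Arguments.
Unset Strict Implicit.
Unset Printing Implicit Defensive.

Import Order.TTheory GRing.Theory Num.Theory.
Local Open Scope classical_set_scope.
Local Open Scope ring_scope.

(** By maximality, adjoining an index [k] outside [S] creates a linear relation. Its coefficient at
    [k] is nonzero, so it can be solved for [f k]. *)
Lemma lin_indep_max_span (R : realType) (B : Type) (I : finType)
    (f : I -> B -> R) (S : {set I}) (k : I) :
  lin_indep f S -> max_indep_card f = #|S| ->
  exists c : I -> R, forall b, f k b = \sum_(j in S) c j * f j b.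
Proof.
move=> indS maxS; have [kS|kS] := boolP (k \in S).
  exists (fun j => (j == k)%:R) => b.
  rewrite (bigD1 k)//= eqxx mul1r big1 ?addr0// => j /andP[_ /negbTE ->].
  by rewrite mul0r.
have [indkS|] := pselect (lin_indep f (k |: S)%SET).
  have : (#|(k |: S)%SET| <= max_indep_card f)%N.
    rewrite /max_indep_card; apply: (leq_bigmax_cond (k |: S)%SET).
    exact/asboolP.
  by rewrite maxS cardsU1 kS ltnn.
move=> /existsNP[c /not_implyP[c0 /existsNP[j /not_implyP[jkS cj]]]].
have cE b : c k * f k b = - \sum_(i in S) c i * f i b.
  by have := c0 b; rewrite big_setU1//= => /eqP; rewrite addr_eq0 => /eqP.
(* If [c k] vanished, the relation would live on [S], whose independence would kill every
   coefficient, including the nonzero [c j]. *)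
have [ck0|ck0] := eqVneq (c k) 0.
  have cS : forall i, i \in S -> c i = 0.
    apply: indS => b; apply/eqP; rewrite -oppr_eq0 -cE ck0.
    by rewrite mul0r.
  by case: cj; case/setU1P: jkS => [->|/cS].
exists (fun i => - (c k)^-1 * c i) => b.
rewrite -[LHS](mulKf ck0) cE mulrN -mulNr mulr_sumr.
by apply: eq_bigr => i _; rewrite mulrA.
Qed.

Lemma integral_lin_comb (R : realType) (d : measure_display)
    (B : measurableType d) (Q : probability B R) (I : finType)
    (f : I -> B -> R) (S : {set I}) (c : I -> R) :
  (forall j, Q.-integrable setT (EFin \o f j)) ->
  (\int[Q]_b (\sum_(j in S) c j * f j b)%:E
   = \sum_(j in S) (c j)%:E * \int[Q]_b (f j b)%:E)%E.
Proof.
move=> intf; under eq_integral do rewrite -sumEFin.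
have intcf j : Q.-integrable setT (fun b => (c j * f j b)%:E).
  under eq_fun do rewrite EFinM.
  apply: (integrableZl measurableT (c j) (intf j)).
rewrite integral_sum//; apply: eq_bigr => j _.
under eq_integral do rewrite EFinM.
exact: (integralZl measurableT (intf j)).
Qed.

(** Each set is a finite disjoint union of points, so additivity reduces the comparison to
    points. *)
Lemma measure_eq_singletons (R : realType) (d : measure_display)
    (T : measurableType d) (m m' : {measure set T -> \bar R}) :
  finite_set [set: T] -> (forall x : T, measurable [set x]) ->
  (forall x, m [set x] = m' [set x]) -> forall E, m E = m' E.
Proof.
move=> finT mT mm' E.
have finE : finite_set E by exact: sub_finite_set finT.
have tE : trivIset E (@set1 T).
  by move=> x y _ _ [z []]; rewrite /= => -> ->.
have EE : E = \bigcup_(x in E) [set x].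
  by apply/seteqP; split => [x Ex|x [_ Ey ->]//]; exists x.
rewrite EE !measure_fin_bigcup//.
by apply: eq_fsbigr => x _; exact: mm'.
Qed.

Section kernel.
Context (R : realType) (J T : nat) (d : measure_display) (B : measurableType d).
Variables (s : choiceKernel R J T B) (Q : probability B R).

Lemma integrable_ck m y : Q.-integrable setT (fun b => (s (b, m, y))%:E).
Proof.
apply: measurable_bounded_integrable => //.
- exact: le_lt_trans (probability_le1 Q measurableT) (ltry 1).
- exact: measurable_ck.
exists 1; split; first exact: num_real.
move=> x x1 b _ /=; have /andP[s0 s1] := ck_itv s (b, m, y).
by rewrite ger0_norm// (le_trans s1)// ltW.
Qed.

Lemma unit_law_outcome m y :
  unit_law s m Q (snd @^-1` [set y]) = (\int[Q]_b (s (b, m, y))%:E)%E.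
Proof.
rewrite unit_lawE; last first.
  by rewrite -[X in measurable X]setTI; exact: measurable_snd.
rewrite (bigD1 y)//= big1 ?adde0.
  by congr (integral _ _ _); apply/seteqP; split.
move=> z zy; rewrite (_ : [set b | _] = set0) ?integral_set0//.
by rewrite -subset0 => b /= zE; move: zy; rewrite zE eqxx.
Qed.

(** The event is a box whose sides are the whole space except at [i]; all other factors of the
    product law equal 1. *)
Lemma marginal_full_law_coord N (a : 'I_N.+1 -> menu J T) i y :
  marginal (full_law s a Q) [set z | tnth z i = y]
  = (\int[Q]_b (s (b, a i, y))%:E)%E.
Proof.
rewrite /marginal /full_law /= /distribution /pushforward.
pose A j : set (B * outcome J T) :=
  if j == i then snd @^-1` [set y] else setT.
have mA j : measurable (A j).
  rewrite /A; case: ifP => // _.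
  by rewrite -[X in measurable X]setTI; exact: measurable_snd.
rewrite (_ : _ @^-1` _ = [set x | forall j, A j (tnth x j)]); last first.
  apply/seteqP; split => x /=; rewrite tnth_map.
    by move=> xy j; rewrite /A; case: eqVneq => [->|].
  by move=> /(_ i); rewrite /A eqxx.
apply: etrans (product_law_box (fun j => unit_law s (a j) Q) mA) _.
rewrite (bigD1 i)//= big1 ?mule1.
  by rewrite /A eqxx unit_law_outcome.
move=> j /negbTE ji; rewrite /A ji.
exact: (probability_setT (unit_law s (a j) Q)).
Qed.

End kernel.

Section identification.
Context (R : realType) (J T N : nat) (d : measure_display) (B : measurableType d).
Variables (s : choiceKernel R J T B) (a : 'I_N.+1 -> menu J T).
Variables (P : probability (N.+1.-tuple (outcome J T)) R).

(** Tuples carry the product sigma-algebra rather than a discrete one by definition; a point is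
    measurable as a box with singleton sides. *)
Lemma measurable_tuple_set1 (y : N.+1.-tuple (outcome J T)) : measurable [set y].
Proof.
rewrite (_ : [set y] = [set z | forall i, [set tnth y i] (tnth z i)]).
  exact: (@measurable_box _ _ _ (fun i => [set tnth y i])).
by apply/seteqP; split => z /= => [-> //|zy]; apply/eq_from_tnth.
Qed.

(** By independence, the mass of a profile is the product of these integrals, and point masses
    determine a law on finitely many profiles. *)
Lemma eq_integral_rationalizing (Q Q' : probability B R) :
  (forall i y, (\int[Q]_b (s (b, a i, y))%:E = \int[Q']_b (s (b, a i, y))%:E)%E) ->
  rationalizing s a P Q' -> rationalizing s a P Q.
Proof.
move=> QQ' ratQ' E mE; rewrite -ratQ'//; apply: measure_eq_singletons => //.
- exact: (@finite_finset (N.+1.-tuple (outcome J T))).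
- exact: measurable_tuple_set1.
- move=> y; apply: etrans (marginal_full_law s a Q y) _.
  apply: etrans _ (esym (marginal_full_law s a Q' y)).
  by apply: eq_bigr => i _.
Qed.

(** All units facing the same menu share one outcome law under [Q], so averaging over them returns
    the common value. *)
Lemma choice_freq_rationalizing (Q : probability B R) x :
  rationalizing s a P Q -> x \in design_pairs a ->
  (choice_freq a P x.1 x.2)%:E = (\int[Q]_b (s (b, x.1, x.2))%:E)%E.
Proof.
case: x => m y /= ratQ; rewrite inE/= => /andP[/imsetP[i _ mE] _].
have mY j : measurable [set z : N.+1.-tuple (outcome J T) | tnth z j = y].
  rewrite -[X in measurable X]setTI.
  exact: (measurable_tnth j measurableT (Y := [set y])).
rewrite /choice_freq.
set A := [set j | a j == m]%SET.
rewrite (eq_bigl (fun j => j \in A)); last by move=> j; rewrite inE.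
rewrite (eq_bigr (fun=> fine (\int[Q]_b (s (b, m, y))%:E)%E)); last first.
  by move=> j; rewrite inE => /eqP <-; rewrite -ratQ// marginal_full_law_coord.
rewrite sumr_const -[X in _ * X]mulr_natl mulKf.
  by rewrite fineK//; exact: integrable_fin_num (integrable_ck _ _ _ _).
(* The unit [i] faces menu [m], so the number of units divided by is not zero. *)
by rewrite pnatr_eq0 -lt0n; apply/card_gt0P; exists i; rewrite inE mE.
Qed.

(** Realizability supplies a reference [Q'] that rationalizes [P]; a feasible [Q] is shown to share
    all moments with [Q']. *)
Lemma rationalizing_lp_feasible
    (o : 'I_#|design_pairs a| -> menu J T * outcome J T) (Lt : nat) :
  adapted_ordering s o Lt -> realizable s a P ->
  rationalizing s a P = lp_feasible s o Lt P.
Proof.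
move=> [[_ oP] maxLt indLt] [Q' ratQ'].
have freqE Q l : rationalizing s a P Q ->
    (\int[Q]_b (moment s o l b)%:E)%E = (choice_freq a P (o l).1 (o l).2)%:E.
  move=> ratQ; rewrite (choice_freq_rationalizing ratQ)//.
  by apply/oP; exists l.
apply/seteqP; split => [Q ratQ l _|Q feasQ]; first exact: freqE.
set S := [set _ | _]%SET in indLt.
(* [S] is the image of [option 'I_Lt] under widening of indices, with [None] accounting for the
   extra 1 in [Lt.+1]. *)
have cardS : max_indep_card (moment1 s o) = #|S|.
  have leLt : (Lt <= #|design_pairs a|)%N.
    rewrite -ltnS -maxLt -[X in (_ <= X.+1)%N]card_ord -card_option.
    by apply/bigmax_leqP => A _; exact: max_card.
  rewrite maxLt -[in LHS](card_ord Lt) -card_option -cardsT.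
  have winj : injective (widen_ord leLt).
    by move=> u v /(congr1 val)/= uv; exact: val_inj.
  rewrite -(card_imset _ (inj_omap winj)).
  congr #|pred_of_set _|; apply/setP => k; rewrite inE; apply/imsetP/idP.
    by case=> -[l|] _ ->/=.
  case: k => [l lLt|_]; last by exists None.
  by exists (Some (Ordinal lLt)) => //; congr Some; exact: val_inj.
have intf (Q1 : probability B R) k :
    Q1.-integrable setT (EFin \o moment1 s o k).
  case: k => [l|]; first exact: integrable_ck.
  exact: finite_measure_integrable_cst.
have int1 (Q1 : probability B R) : (\int[Q1]_b (moment1 s o None b)%:E = 1)%E.
  apply: etrans (integral_cst Q1 measurableT 1%:E) _.
  by rewrite mul1e; exact: (probability_setT Q1).
(* Expand the moment over [S] and compare term by term: the first [Lt] moments have the prescribed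
   integrals under both measures, and the constant integrates to 1 under both. *)
have momE k : (\int[Q]_b (moment1 s o k b)%:E = \int[Q']_b (moment1 s o k b)%:E)%E.
  have [c cE] := lin_indep_max_span k indLt cardS.
  under eq_integral do rewrite cE.
  under [RHS]eq_integral do rewrite cE.
  rewrite !integral_lin_comb//; apply: eq_bigr => -[l|]; rewrite inE => lLt.
    by rewrite /= feasQ// freqE.
  by rewrite !int1.
apply: eq_integral_rationalizing ratQ' => i y.
(* Outcomes outside the menu index no moment, but there the kernel is zero and both integrals
   vanish. *)
have [ya|ya] := boolP (y \in \val (a i)); last first.
  under eq_integral do rewrite ck_supp//.
  under [RHS]eq_integral do rewrite ck_supp//.
  by rewrite !integral0.
have /oP[l ol] : (a i, y) \in design_pairs a.
  by rewrite inE/= ya andbT imset_f.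
by have := momE (Some l); rewrite /= /moment ol.
Qed.

End identification.

Theorem theorem1 (R : realType) (J T N : nat)
    (d : measure_display) (B : measurableType d)
    (s : choiceKernel R J T B)
    (a : 'I_N.+1 -> menu J T)
    (g : B -> R) (g_meas : measurable_fun [set: B] g)
    (g_itv : forall b, 0 <= g b <= 1)
    (o : 'I_#|design_pairs a| -> menu J T * outcome J T) (Lt : nat)
    (o_adapted : adapted_ordering s o Lt)
    (P : probability (N.+1.-tuple (outcome J T)) R)
    (P_model : np_model a P)
    (P_realizable : realizable s a P) :
  upper_endpoint s g a P = lp_value s g o Lt P.
Proof.
by rewrite /upper_endpoint /identified_set (rationalizing_lp_feasible o_adapted).
Qed.
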